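(* For every directed graph $\Gamma$, the lattice $(\mathcal{CT}(\Gamma),\leq)$ of congruence triples of $\Gamma$ is upper semimodular. However, it is not necessarily lower semimodular: there exists a directed graph $\Gamma$ for which $(\mathcal{CT}(\Gamma),\leq)$ is not lower semimodular.
   Context: Graphs. A directed graph $\Gamma=(V,E,r,s)$ consists of a set $V$ of vertices, a set $E$ of edges and functions $r,s:E\to V$ (range and source); no finiteness is assumed. A cycle is a sequence $c=e_1\cdots e_n$ ($n\geq 1$) of edges with $r(e_i)=s(e_{i+1})$ for $1\leq i\leq n-1$, $r(e_n)=s(e_1)$, and $s(e_i)\neq s(e_j)$ whenever $i\neq j$; put $u(c)=\{s(e_i):1\leq i\leq n\}$. For $V_1\subseteq V$, $\mathrm{C}(V_1)$ is the set of all cycles $c$ with $u(c)\subseteq V_1$. Congruence triples. $H\subseteq V$ is hereditary if $s(e)\in H$ implies $r(e)\in H$ for all $e\in E$. For hereditary $H$ and $v\in V$, the index of $v$ relative to $H$ is $|\{e\in E: s(e)=v,\ r(e)\notin H\}|$. A congruence triple of $\Gamma$ is a triple $(H,W,f)$ where $H$ is a hereditary subset of $V$, $W$ is a subset of the set of vertices having index $1$ relative to $H$ (so $H\cap W=\emptyset$), and $f:\mathrm{C}(W)\to\mathbb{Z}^+\cup\{\infty\}$ is a cycle function on $W$, i.e. invariant under cyclic permutations of cycles. The function $f$ is always replaced by its extension to $\mathrm{C}(V)$ (still denoted $f$): $f(c)=1$ if $c\in\mathrm{C}(H)$, $f(c)$ unchanged if $c\in\mathrm{C}(W)$, and $f(c)=\infty$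 for all other $c\in\mathrm{C}(V)$. $\mathcal{CT}(\Gamma)$ is the set of all these (extended) congruence triples. Order. Every element of $\mathbb{Z}^+\cup\{\infty\}$ divides $\infty$ (and $\infty$ divides only $\infty$). $(H_1,W_1,f_1)\leq(H_2,W_2,f_2)$ means $H_1\subseteq H_2$, $W_1\setminus H_2\subseteq W_2$ and $f_2(c)\mid f_1(c)$ for all $c\in\mathrm{C}(V)$. This is a partial order, and $(\mathcal{CT}(\Gamma),\leq)$ is a lattice. Lattices. In a lattice $L$, $a\succ b$ ($a$ covers $b$) means $a> b$ and there is no $x\in L$ with $a> x> b$. $L$ is upper semimodular if, for all $a,b\in L$, $a\succ a\wedge b$ and $b\succ a\wedge b$ imply $a\vee b\succ a$ and $a\vee b\succ b$. $L$ is lower semimodular if, for all $a,b\in L$, $a\vee b\succ a$ and $a\vee b\succ b$ imply $a\succ a\wedge b$ and $b\succ a\wedge b$. *)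

(* Defs.v *)
From HB Require Import structures.
From mathcomp Require Import all_boot all_order.
From mathcomp Require Import boolp classical_sets cardinality.

Set Implicit Arguments.
Unset Strict Implicit.
Unset Printing Implicit Defensive.

Import Order.TTheory.
Local Open Scope classical_set_scope.
Local Open Scope card_scope.

Record digraph := Digraph {
  vertex : Type;
  edge : Type;
  rng : edge -> vertex;
  src : edge -> vertex
}.

Arguments rng {_} _.
Arguments src {_} _.

(* Classical equality and choice: only used to write [uniq] and [\in] on
   vertices; vertices and edges are arbitrary types. *)
HB.instance Definition _ (G : digraph) := gen_eqMixin (vertex G).
HB.instance Definition _ (G : digraph) := gen_choiceMixin (vertex G).

Section Cycles.
Variable G : digraph.
Implicit Types (c : seq (edge G)) (H : set (vertex G)).

(* [cycle] is the closed walk predicate of [path], which wraps around from the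
   last item to the first one; it accepts the empty sequence. *)
Definition is_gcycle c : bool :=
  [&& (0 < size c)%N, cycle [rel e e' | rng e == src e'] c
    & uniq [seq src e | e <- c]].

(* A cycle has a starting edge: rotating it gives in general another cycle. *)
Definition gcycle := {c : seq (edge G) | is_gcycle c}.

Definition cycle_vertices (c : gcycle) : set (vertex G) :=
  [set v | v \in [seq src e | e <- val c]].

Definition cycles_in H : set gcycle := [set c | cycle_vertices c `<=` H].

Definition cyclic_permutation (c c' : gcycle) : Prop :=
  exists n, val c' = rot n (val c).

Definition hereditary H : Prop := forall e, H (src e) -> H (rng e).

Definition has_index H (v : vertex G) (n : nat) : Prop :=
  [set e : edge G | src e = v /\ ~ H (rng e)] #= `I_n.

End Cycles.

Arguments cycles_in {G} H.

(* Positive integers together with infinity, which is [None]. *)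
Definition posinf := option {n : nat | (0 < n)%N}.

Definition posinf1 : posinf := Some (exist _ 1%N isT).

Definition posinf_dvd (a b : posinf) : bool :=
  match a, b with
  | _, None => true
  | None, Some _ => false
  | Some m, Some n => (val m %| val n)%N
  end.

(* The function is the extended one, defined on all cycles of the graph; its
   values outside [cycles_in ct_W] are forced by the last two fields, so that
   equality of records is equality of triples. *)
Record congruence_triple (G : digraph) := CongruenceTriple {
  ct_H : set (vertex G);
  ct_W : set (vertex G);
  ct_f : gcycle G -> posinf;
  ct_hereditary : hereditary ct_H;
  ct_index : ct_W `<=` [set v | has_index ct_H v 1];
  ct_cyclic : forall c c', cycles_in ct_W c -> cyclic_permutation c c' ->
    ct_f c' = ct_f c;
  ct_f_in_H : forall c, cycles_in ct_H c -> ct_f c = posinf1;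
  ct_f_else : forall c, ~ cycles_in ct_H c -> ~ cycles_in ct_W c ->
    ct_f c = None
}.

Definition ct_le (G : digraph) (t1 t2 : congruence_triple G) : Prop :=
  [/\ ct_H t1 `<=` ct_H t2,
      ct_W t1 `\` ct_H t2 `<=` ct_W t2
    & forall c : gcycle G, posinf_dvd (ct_f t2 c) (ct_f t1 c)].

Section PosInf.

(* Divisibility on [posinf] is divisibility on [nat], with 0 for infinity. *)
Definition nat_of_posinf (a : posinf) : nat := oapp val 0%N a.
Definition posinf_of_nat (n : nat) : posinf := insub n.

Lemma nat_of_posinfK : cancel nat_of_posinf posinf_of_nat.
Proof. by case=> [n|] //=; rewrite /posinf_of_nat ?valK ?insubF. Qed.

Lemma posinf_of_natK : cancel posinf_of_nat nat_of_posinf.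
Proof.
by rewrite /posinf_of_nat => n; case: insubP => [u _ <-|] //=; case: n.
Qed.

Lemma posinf_dvdE a b : posinf_dvd a b = (nat_of_posinf a %| nat_of_posinf b)%N.
Proof.
case: a b => [m|] [n|] //=; rewrite ?dvdn0 // dvd0n.
by case: n => n n_gt0 /=; rewrite eqn0Ngt n_gt0.
Qed.

Lemma posinf_dvdxx a : posinf_dvd a a.
Proof. by rewrite posinf_dvdE. Qed.

Lemma posinf_dvd_trans b a c : posinf_dvd a b -> posinf_dvd b c -> posinf_dvd a c.
Proof. by rewrite !posinf_dvdE; exact: dvdn_trans. Qed.

Lemma posinf_dvd_anti a b : posinf_dvd a b -> posinf_dvd b a -> a = b.
Proof.
rewrite !posinf_dvdE => ab ba; apply: (can_inj nat_of_posinfK).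
by apply/eqP; rewrite eqn_dvd ab.
Qed.

Lemma posinf_dvdx0 a : posinf_dvd a None.
Proof. by case: a. Qed.

Lemma posinf_dvd1x a : posinf_dvd posinf1 a.
Proof. by rewrite posinf_dvdE dvd1n. Qed.

Lemma posinf_dvd_eq0 a : posinf_dvd None a -> a = None.
Proof. by case: a. Qed.

Definition posinf_gcd a b :=
  posinf_of_nat (gcdn (nat_of_posinf a) (nat_of_posinf b)).
Definition posinf_lcm a b :=
  posinf_of_nat (lcmn (nat_of_posinf a) (nat_of_posinf b)).

Lemma posinf_dvd_gcd c a b :
  posinf_dvd c (posinf_gcd a b) = posinf_dvd c a && posinf_dvd c b.
Proof. by rewrite !posinf_dvdE posinf_of_natK dvdn_gcd. Qed.

Lemma posinf_dvd_lcm c a b :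
  posinf_dvd (posinf_lcm a b) c = posinf_dvd a c && posinf_dvd b c.
Proof. by rewrite !posinf_dvdE posinf_of_natK dvdn_lcm. Qed.

End PosInf.

Section Lattice.
Variable G : digraph.
Implicit Types (H W : set (vertex G)) (c : gcycle G) (t : congruence_triple G).

Lemma has_index1P H (v : vertex G) :
  has_index H v 1 <-> exists! e : edge G, src e = v /\ ~ H (rng e).
Proof.
rewrite /has_index; set A := [set e | _]; split=> [|[e [Ae e_uniq]]]; last first.
  suff -> : A = [set e] by exact: card_set1.
  by apply/seteqP; split=> [e' /e_uniq <-//|_ ->].
move=> /card_set_bijP[f [fun_f inj_f surj_f]].
have f0 e : A e -> f e = 0%N by move=> /fun_f /=; case: (f e).
have [e Ae fe] := surj_f 0%N erefl.
exists e; split=> // e' Ae'; apply: inj_f; rewrite ?inE //.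
by rewrite !f0.
Qed.

Lemma cycles_in_sub H W c : H `<=` W -> cycles_in H c -> cycles_in W c.
Proof. by move=> HW Hc v /Hc /HW. Qed.

Lemma cyclic_permutation_in H c c' : cyclic_permutation c c' ->
  cycles_in H c' <-> cycles_in H c.
Proof.
move=> [n c'E]; rewrite /cycles_in /cycle_vertices /= c'E map_rot.
by split=> Hc v; have := Hc v; rewrite /= mem_rot.
Qed.

Lemma cycle_vertices_neq0 c : exists v, cycle_vertices c v.
Proof.
case: c => -[|e c] // cP; exists (src e).
by rewrite /cycle_vertices /= inE eqxx.
Qed.

Lemma cycle_meets_hereditary H c v : hereditary H ->
  cycle_vertices c v -> H v -> cycles_in H c.
Proof.
move=> herH; case: c => c; rewrite /cycles_in /cycle_vertices /=.
move=> /and3P[_ c_cycle _] vc Hv w /= wc.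
move: (rot_index vc) c_cycle wc; set i := index _ _.
rewrite -map_rot -(rot_cycle i) -(mem_rot i) -map_rot.
case: (rot i c) => //= e p [ev _]; rewrite rcons_path => /andP[+ _].
rewrite -ev in Hv; move: {ev} Hv; rewrite inE.
elim: p e => /= [|e' p IH] e He; first by rewrite orbF => _ /eqP ->.
move=> /andP[/asboolP ee' e'p] /orP[/eqP -> //|].
by rewrite inE; apply: IH => //; rewrite -ee'; exact: herH.
Qed.

Lemma index_notin H v : has_index H v 1 -> hereditary H -> ~ H v.
Proof.
move=> /has_index1P[e [[<- nHe] _]] herH He.
by apply: nHe; exact: herH.
Qed.

Lemma ct_le_refl t : ct_le t t.
Proof. by split=> [v //|v [] //|c]; exact: posinf_dvdxx. Qed.

Lemma ct_le_anti t1 t2 : ct_le t1 t2 -> ct_le t2 t1 -> t1 = t2.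
Proof.
move=> [leH leW lef] [leH' leW' lef'].
have WH t v : ct_W t v -> ~ ct_H t v.
  by move=> /ct_index/index_notin; apply; exact: ct_hereditary.
have eqH : ct_H t1 = ct_H t2 by apply/seteqP.
have eqW : ct_W t1 = ct_W t2.
  apply/seteqP; split=> v Wv.
    by apply: leW; split=> //; rewrite -eqH; exact: WH.
  by apply: leW'; split=> //; rewrite eqH; exact: WH.
have eqf : ct_f t1 = ct_f t2.
  by apply/funext => c; exact: posinf_dvd_anti.
case: t1 t2 eqH eqW eqf {leH leW lef leH' leW' lef'} =>
  [H1 W1 f1 ? ? ? ? ?] [H2 W2 f2 ? ? ? ? ?] /= eqH eqW eqf.
by subst H2 W2 f2; f_equal; exact: Prop_irrelevance.
Qed.

Lemma ct_le_trans t2 t1 t3 : ct_le t1 t2 -> ct_le t2 t3 -> ct_le t1 t3.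
Proof.
move=> [leH leW lef] [leH' leW' lef']; split.
- by move=> v /leH/leH'.
- by move=> v [Wv nHv]; apply: leW'; split=> //; apply: leW; split=> // /leH'.
- by move=> c; exact: posinf_dvd_trans (lef' c) (lef c).
Qed.

Lemma ct_inv t c c' : cyclic_permutation c c' -> ct_f t c' = ct_f t c.
Proof.
move=> cc'; have [Wc|nWc] := pselect (cycles_in (ct_W t) c).
  exact: ct_cyclic.
have [Hc|nHc] := pselect (cycles_in (ct_H t) c).
  by rewrite !ct_f_in_H //; apply/(cyclic_permutation_in _ cc').
by rewrite !ct_f_else // => /(cyclic_permutation_in _ cc').
Qed.

Lemma ct_f_cases t c : cycles_in (ct_H t) c \/ cycles_in (ct_W t) c
  \/ ct_f t c = None.
Proof.
have [?|nH] := pselect (cycles_in (ct_H t) c); first by left.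
have [?|nW] := pselect (cycles_in (ct_W t) c); first by right; left.
by right; right; exact: ct_f_else.
Qed.

Definition extend H W (g : gcycle G -> posinf) c : posinf :=
  if `[< cycles_in H c >] then posinf1
  else if `[< cycles_in W c >] then g c else None.

Section Extend.
Variables (H W : set (vertex G)) (g : gcycle G -> posinf).
Hypothesis HW : W `<=` [set v | has_index H v 1].
Hypothesis herH : hereditary H.
Hypothesis g_inv : forall c c', cyclic_permutation c c' -> g c' = g c.

Lemma extend_cyclic c c' : cycles_in W c -> cyclic_permutation c c' ->
  extend H W g c' = extend H W g c.
Proof.
move=> _ cc'; rewrite /extend (g_inv cc').
by rewrite !(asbool_equiv_eq (cyclic_permutation_in _ cc')).
Qed.

Lemma extend_in c : cycles_in H c -> extend H W g c = posinf1.
Proof. by move=> Hc; rewrite /extend asboolT. Qed.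

Lemma extend_else c : ~ cycles_in H c -> ~ cycles_in W c ->
  extend H W g c = None.
Proof. by move=> nH nW; rewrite /extend !asboolF. Qed.

Definition triple_of : congruence_triple G :=
  CongruenceTriple herH HW extend_cyclic extend_in extend_else.

End Extend.

Section Meet.
Variables t1 t2 : congruence_triple G.

Let H := ct_H t1 `&` ct_H t2.
Let W := [set v | [/\ (ct_H t1 `|` ct_W t1) v, (ct_H t2 `|` ct_W t2) v
  & has_index H v 1]].
Let f c := posinf_lcm (ct_f t1 c) (ct_f t2 c).

Fact meet_hereditary : hereditary H.
Proof. by move=> e [? ?]; split; exact: ct_hereditary. Qed.

Fact meet_index : W `<=` [set v | has_index H v 1].
Proof. by move=> v []. Qed.

Fact meet_inv c c' : cyclic_permutation c c' -> f c' = f c.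
Proof. by move=> cc'; rewrite /f !(ct_inv _ cc'). Qed.

Definition ct_meet := triple_of meet_index meet_hereditary meet_inv.

Lemma ct_meet_f c : posinf_dvd (f c) (ct_f ct_meet c).
Proof.
rewrite /= /extend; case: asboolP => [Hc|_]; last first.
  by case: ifP => _; rewrite ?posinf_dvdxx ?posinf_dvdx0.
by rewrite /f posinf_dvd_lcm !ct_f_in_H ?posinf_dvdxx //;
  apply: cycles_in_sub Hc => v [].
Qed.

Lemma ct_meet_lel : ct_le ct_meet t1.
Proof.
split=> [v []//|v [[[]//]]|c].
by have := ct_meet_f c; rewrite posinf_dvd_lcm => /andP[].
Qed.

Lemma ct_meet_ler : ct_le ct_meet t2.
Proof.
split=> [v []//|v [[_ []//]]|c].
by have := ct_meet_f c; rewrite posinf_dvd_lcm => /andP[].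
Qed.

Lemma ct_le_meet t : ct_le t t1 -> ct_le t t2 -> ct_le t ct_meet.
Proof.
move=> [leH1 leW1 lef1] [leH2 leW2 lef2].
have leH : ct_H t `<=` H by move=> v Hv; split; [exact: leH1|exact: leH2].
have leW : ct_W t `\` H `<=` W.
  move=> v [Wv nHv].
  have W1v : (ct_H t1 `|` ct_W t1) v.
    by have [|] := pselect (ct_H t1 v); [left|right; exact: leW1].
  have W2v : (ct_H t2 `|` ct_W t2) v.
    by have [|] := pselect (ct_H t2 v); [left|right; exact: leW2].
  split=> //; apply/has_index1P.
  have /has_index1P[e [_ e_uniq]] := ct_index Wv.
  suff [e' [e'v e'H]] : exists e' : edge G, src e' = v /\ ~ H (rng e').
    exists e'; split=> // e'' [e''v e''H].
    by transitivity e; [symmetry|]; apply: e_uniq; split=> // /leH.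
  have [H1v|nH1v] := pselect (ct_H t1 v).
    have [//|W2v'] : (ct_H t2 `|` ct_W t2) v by [].
      by move=> H2v; case: nHv.
    have /has_index1P[e' [[e'v e'H] _]] := ct_index W2v'.
    by exists e'; split=> // -[].
  case: W1v => // W1v; have /has_index1P[e' [[e'v e'H] _]] := ct_index W1v.
  by exists e'; split=> // -[].
split=> // c; have [Hc|nHc] := pselect (cycles_in H c).
  by rewrite ct_f_in_H // posinf_dvd1x.
have [Ht|[Wt|->]] := ct_f_cases t c; last exact: posinf_dvdx0.
  by case: nHc; exact: cycles_in_sub Ht.
have Wc : cycles_in W c.
  move=> v vc; apply: leW; split; first exact: Wt.
  by move=> Hv; apply: nHc; exact: cycle_meets_hereditary meet_hereditary vc Hv.
by rewrite /= /extend asboolF // asboolT // posinf_dvd_lcm lef1 lef2.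
Qed.

End Meet.

Section Join.
Variables t1 t2 : congruence_triple G.

Let W12 := ct_W t1 `|` ct_W t2.

Inductive join_H : set (vertex G) :=
| join_H_base v : (ct_H t1 `|` ct_H t2) v -> join_H v
| join_H_step v : W12 v -> (forall e : edge G, src e = v -> join_H (rng e)) ->
    join_H v.

Let W := W12 `\` join_H.
Let f c := posinf_gcd (ct_f t1 c) (ct_f t2 c).

Fact join_hereditary : hereditary join_H.
Proof.
move=> e He; move ev: (src e) He => v He.
case: He ev => {}v; last by move=> _ /[apply].
by case=> + ev; rewrite -ev => /ct_hereditary ?; apply: join_H_base;
  [left|right].
Qed.

Fact join_index : W `<=` [set v | has_index join_H v 1].
Proof.
move=> v [Wv nHv]; apply/has_index1P.
have [e e_uniq] : exists e : edge G,
    forall e', src e' = v /\ ~ join_H (rng e') -> e = e'.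
  by case: Wv => /ct_index/has_index1P[e [_ e_uniq]]; exists e => e' [e'v nHe'];
    apply: e_uniq; split=> // Hv; apply: nHe'; apply: join_H_base;
    [left|right].
have [e' [e'v nHe']] : exists e' : edge G, src e' = v /\ ~ join_H (rng e').
  apply: contrapT => nex; apply: nHv; apply: join_H_step => // e' e'v.
  by apply: contrapT => nHe'; apply: nex; exists e'.
by exists e'; split=> // e'' e''P; rewrite -(e_uniq e'') // -(e_uniq e').
Qed.

Fact join_inv c c' : cyclic_permutation c c' -> f c' = f c.
Proof. by move=> cc'; rewrite /f !(ct_inv _ cc'). Qed.

Definition ct_join := triple_of join_index join_hereditary join_inv.

Lemma ct_join_f t c : ct_H t `<=` join_H -> ct_W t `<=` W12 ->
  posinf_dvd (f c) (ct_f t c) -> posinf_dvd (ct_f ct_join c) (ct_f t c).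
Proof.
move=> leH leW lef; have [Hc|nHc] := pselect (cycles_in join_H c).
  by rewrite ct_f_in_H // posinf_dvd1x.
have [Ht|[Wt|->]] := ct_f_cases t c; last exact: posinf_dvdx0.
  by case: nHc; exact: cycles_in_sub Ht.
have Wc : cycles_in W c.
  move=> v vc; split; first by apply: leW; exact: Wt.
  by move=> Hv; apply: nHc; exact: cycle_meets_hereditary join_hereditary vc Hv.
by rewrite /= /extend asboolF // asboolT.
Qed.

Lemma ct_le_joinl : ct_le t1 ct_join.
Proof.
have leH : ct_H t1 `<=` join_H by move=> v Hv; apply: join_H_base; left.
split=> // [v [Wv nHv]|c]; first by split=> //; left.
apply: ct_join_f => // [v|]; first by left.
by have := posinf_dvdxx (f c); rewrite posinf_dvd_gcd => /andP[].
Qed.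

Lemma ct_le_joinr : ct_le t2 ct_join.
Proof.
have leH : ct_H t2 `<=` join_H by move=> v Hv; apply: join_H_base; right.
split=> // [v [Wv nHv]|c]; first by split=> //; right.
apply: ct_join_f => // [v|]; first by right.
by have := posinf_dvdxx (f c); rewrite posinf_dvd_gcd => /andP[].
Qed.

Lemma ct_join_le t : ct_le t1 t -> ct_le t2 t -> ct_le ct_join t.
Proof.
move=> [leH1 leW1 lef1] [leH2 leW2 lef2].
have leW v : W12 v -> ~ ct_H t v -> ct_W t v.
  by move=> [Wv|Wv] nHv; [apply: leW1|apply: leW2].
have leH : join_H `<=` ct_H t.
  move=> v; elim=> {}v; first by move=> [/leH1|/leH2].
  move=> Wv _ IH; apply: contrapT => nHv.
  have /has_index1P[e [[ev nHe] _]] := ct_index (leW v Wv nHv).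
  by apply: nHe; exact: IH.
split=> // [v [[Wv _] nHv]|c]; first exact: leW.
rewrite /= /extend; case: asboolP => [Hc|_].
  by rewrite ct_f_in_H ?posinf_dvdxx //; exact: cycles_in_sub Hc.
case: asboolP => _; last exact: posinf_dvdx0.
by rewrite posinf_dvd_gcd lef1 lef2.
Qed.

End Join.

Definition ct_leb t1 t2 : bool := `[< ct_le t1 t2 >].

Fact ct_leb_refl : reflexive ct_leb.
Proof. by move=> t; apply/asboolP; exact: ct_le_refl. Qed.

Fact ct_leb_anti : antisymmetric ct_leb.
Proof. by move=> t1 t2 /andP[/asboolP + /asboolP]; exact: ct_le_anti. Qed.

Fact ct_leb_trans : transitive ct_leb.
Proof.
move=> t2 t1 t3 /asboolP t12 /asboolP t23; apply/asboolP.
exact: ct_le_trans t12 t23.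
Qed.

Fact ct_leb_meet t t1 t2 :
  ct_leb t (ct_meet t1 t2) = ct_leb t t1 && ct_leb t t2.
Proof.
apply/asboolP/andP => [le|[/asboolP le1 /asboolP le2]]; last exact: ct_le_meet.
by split; apply/asboolP; apply: ct_le_trans le _;
  [exact: ct_meet_lel|exact: ct_meet_ler].
Qed.

Fact ct_leb_join t1 t2 t :
  ct_leb (ct_join t1 t2) t = ct_leb t1 t && ct_leb t2 t.
Proof.
apply/asboolP/andP => [le|[/asboolP le1 /asboolP le2]]; last exact: ct_join_le.
by split; apply/asboolP; apply: ct_le_trans le;
  [exact: ct_le_joinl|exact: ct_le_joinr].
Qed.

End Lattice.

Fact ct_display : Order.disp_t. Proof. exact: Order.Disp tt tt. Qed.

HB.instance Definition _ (G : digraph) := gen_eqMixin (congruence_triple G).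
HB.instance Definition _ (G : digraph) := gen_choiceMixin (congruence_triple G).
HB.instance Definition _ (G : digraph) :=
  Order.Le_isPOrder.Build ct_display (congruence_triple G)
    (@ct_leb_refl G) (@ct_leb_anti G) (@ct_leb_trans G).
HB.instance Definition _ (G : digraph) :=
  Order.POrder_MeetJoin_isLattice.Build ct_display
    (congruence_triple G) (@ct_leb_meet G) (@ct_leb_join G).

Lemma ct_leP (G : digraph) (t1 t2 : congruence_triple G) :
  reflect (ct_le t1 t2) (t1 <= t2)%O.
Proof. exact: asboolP. Qed.

Section Semimodularity.
Local Open Scope order_scope.
Context {d : Order.disp_t}.

Definition covers (L : latticeType d) (a b : L) : Prop :=
  b < a /\ ~ exists x : L, b < x /\ x < a.

Definition upper_semimodular (L : latticeType d) : Prop :=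
  forall a b : L, covers a (a `&` b) -> covers b (a `&` b) ->
    covers (a `|` b) a /\ covers (a `|` b) b.

Definition lower_semimodular (L : latticeType d) : Prop :=
  forall a b : L, covers (a `|` b) a -> covers (a `|` b) b ->
    covers a (a `&` b) /\ covers b (a `&` b).

End Semimodularity.

(* Main.v *)
From HB Require Import structures.
Require Import Defs.
From mathcomp Require Import all_boot all_order.
From mathcomp Require Import boolp classical_sets cardinality.

(** A failure of upper semimodularity gives covers [a], [b] of
    [m = a `&` b] and some [x] with [a < x < a `|` b]; since [b] covers [m],
    necessarily [x `&` b = m].  The only other consequence of covering that is
    needed is that every vertex of [ct_W b] has index 1 relative to [ct_H m]:
    if [ct_H b] differs from [ct_H m], then the triple [(H_b, W_m \ H_b, f_b)]
    lies between [m] and [b] and so equals [b], whence [W_b] is contained in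
    [W_m].  This forces, in turn, the three components of [x] to be those of
    [a].

    Lower semimodularity fails for a vertex with two edges to distinct sinks
    [u] and [u']: the triples [({u}, {v})] and [({u'}, {v})] are covered by
    their join, but their meet is trivial, and [({u}, set0)] lies strictly
    between it and [({u}, {v})]. *)

Import Order.TTheory.
Local Open Scope classical_set_scope.
Local Open Scope order_scope.

HB.instance Definition _ (G : digraph) := gen_eqMixin (edge G).

(** Divisibility is a distributive lattice, so [m] is the lcm of [gcdn n m] and [gcdn p m], both
    divisors of [n]. *)
Lemma dvdn_lcm_gcd m n p :
  (m %| lcmn n p -> gcdn m p %| n -> m %| n)%N.
Proof.
move=> m_dvd mp_dvd; rewrite -(gcdn_idPr m_dvd).
have -> : gcdn (lcmn n p) m = lcmn (gcdn n m) (gcdn p m).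
  exact: (@meetUl _ natdvd).
by rewrite dvdn_lcm dvdn_gcdl gcdnC.
Qed.

Section UpperSemimodular.
Context {G : digraph}.
Implicit Types (t a b m x : congruence_triple G) (c : gcycle G).
Implicit Types (v : vertex G) (H : set (vertex G)).

Lemma cycle_next c v : cycle_vertices c v ->
  exists2 e : edge G, src e = v & cycle_vertices c (rng e).
Proof.
case: c => s sP; rewrite /cycle_vertices /= => /mapP[e es ->].
have /and3P[_ s_cycle _] := sP.
exists e => //; have /= /asboolP -> := next_cycle s_cycle es.
by apply: map_f; rewrite mem_next.
Qed.

(** A vertex added by [join_H_step] passes the claim on to its successor on the cycle; at a base
    vertex, heredity captures the whole cycle. *)
Lemma cycles_in_join_H a b c : cycles_in (join_H a b) c ->
  cycles_in (ct_H a) c \/ cycles_in (ct_H b) c.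
Proof.
move=> Jc; have [v vc] := cycle_vertices_neq0 c.
elim: (Jc v vc) (vc) => {v vc} v.
  by case=> Hv vc; [left|right];
    apply: cycle_meets_hereditary vc Hv; exact: ct_hereditary.
by move=> _ _ IH /cycle_next[e ev ec]; exact: IH ev ec.
Qed.

Lemma cycles_inI H t c : cycles_in (ct_W t) c -> hereditary H ->
  ~ cycles_in H c -> cycles_in (ct_W t `\` H) c.
Proof.
move=> Wc herH nHc v vc; split; first exact: Wc.
by move=> Hv; apply: nHc; exact: cycle_meets_hereditary herH vc Hv.
Qed.

Lemma covers_index t m : covers t m ->
  ct_W t `<=` [set v | has_index (ct_H m) v 1].
Proof.
move=> [mt no_between] v Wv.
have /ct_leP[leH leW lef] := ltW mt.
have yW : ct_W m `\` ct_H t `<=` [set v | has_index (ct_H t) v 1].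
  by move=> w /leW /ct_index.
pose y := triple_of yW (@ct_hereditary _ t) (@ct_inv _ t).
have my : m <= y.
  apply/ct_leP; split=> // c; rewrite /= /extend.
  case: asboolP => [_|nHc]; first exact: posinf_dvd1x.
  case: asboolP => [_|nWc]; first exact: lef.
  have [Hc|[Wc|->]] := ct_f_cases m c; last exact: posinf_dvdx0.
    by case: nHc; exact: cycles_in_sub Hc.
  by case: nWc; apply: cycles_inI => //; exact: ct_hereditary.
have yt : y <= t.
  apply/ct_leP; split=> // [w [[wW wH] _]|c]; first exact: leW.
  rewrite /= /extend; case: asboolP => [Hc|_].
    by rewrite ct_f_in_H // posinf_dvdxx.
  by case: asboolP => _; rewrite ?posinf_dvdxx ?posinf_dvdx0.
have [ym|ny] := eqVneq y m.
  by have /= -> := congr1 (@ct_H G) (esym ym); exact: ct_index.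
have [yt'|nyt] := eqVneq y t.
  by move: Wv; rewrite -yt' /= => -[/ct_index].
by case: no_between; exists y; rewrite !lt_neqAle eq_sym ny nyt my yt.
Qed.

Lemma modular_meet_join {a b x m} :
  ct_W b `<=` [set v | has_index (ct_H m) v 1] ->
  a `&` b = m -> x `&` b = m -> a <= x -> x <= a `|` b -> x <= a.
Proof.
move=> Wb1 abm xbm /ct_leP[axH axW axf] /ct_leP[xjH xjW xjf].
have HabE : ct_H m = ct_H a `&` ct_H b by rewrite -abm.
have HxbE : ct_H m = ct_H x `&` ct_H b by rewrite -xbm.
have Wm v : (ct_H x `|` ct_W x) v -> (ct_H b `|` ct_W b) v ->
    has_index (ct_H m) v 1 -> ct_W m v.
  by move=> xv bv; rewrite HxbE -xbm; split.
have Wma v : ct_W m v -> (ct_H a `|` ct_W a) v.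
  by rewrite -abm => -[].
(* A [join_H_step] vertex of [ct_H x] has all out-neighbours in [ct_H a] by induction, so it is not
   in [ct_W a]. It is then in [ct_W b], so in [ct_W m], so in [ct_H a]. *)
have HxE : ct_H x = ct_H a.
  apply/seteqP; split=> // v Hv; elim: (xjH v Hv) (Hv) => {v Hv} v.
    case=> // Hbv Hxv; have : ct_H m v by rewrite HxbE.
    by rewrite HabE => -[].
  move=> Wv _ IH Hxv.
  have nWa : ~ ct_W a v.
    move=> /ct_index/has_index1P[e [[ev nHe] _]]; apply: nHe.
    by apply: IH => //; apply: ct_hereditary; rewrite ev.
  case: Wv => // Wv; have /Wma[//|/nWa[]] : ct_W m v.
  by apply: Wm; [left|right|exact: Wb1].
(* All out-neighbours of [v] lie in [ct_H b], so its indices relative to [ct_H m] and [ct_H x]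
   agree. *)
have Wm_Hb v : ct_W x v -> ct_H b v -> ct_W m v.
  move=> Wxv Hbv; apply: Wm; [by right|by left|].
  have := ct_index Wxv; rewrite /= HxbE => /has_index1P[e [[ev nHe] e_uniq]].
  apply/has_index1P; exists e; split; first by split=> // -[].
  move=> e' [e'v nHe']; apply: e_uniq; split=> // Hxe'; apply: nHe'.
  by split=> //; apply: ct_hereditary; rewrite e'v.
have Wm_Wb v : ct_W x v -> ct_W b v -> ct_W m v.
  by move=> Wxv Wbv; apply: Wm; [right|right|exact: Wb1].
have nHaW v : ct_W x v -> ~ ct_H a v.
  by rewrite -HxE => /ct_index/index_notin; apply; exact: ct_hereditary.
have WxE : ct_W x `<=` ct_W a.
  move=> v Wxv; have nHav := nHaW v Wxv.
  have Wm_Wa : ct_W m v -> ct_W a v by move=> /Wma[].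
  (* Either way [v] is in [ct_W a], [ct_H b] or [ct_W b]; the last two lead to [ct_W a] through
     [ct_W m]. *)
  have [Jv|nJv] := pselect (join_H a b v).
    case: Jv Wxv nHav Wm_Wa {nHaW} => {}v => [[//|Hbv]|[//|Wbv] _] Wxv _; apply.
      exact: Wm_Hb.
    exact: Wm_Wb.
  by have [[//|Wbv] _] := xjW v (conj Wxv nJv); apply: Wm_Wa; exact: Wm_Wb.
apply/ct_leP; split=> [|v [/WxE]//|c]; first by rewrite HxE.
have [Hc|[Wc|->]] := ct_f_cases x c; last exact: posinf_dvdx0.
  by rewrite ct_f_in_H ?posinf_dvd1x // -HxE.
have nHac : ~ cycles_in (ct_H a) c.
  have [v vc] := cycle_vertices_neq0 c.
  by move=> Hac; apply: nHaW (Wc v vc) (Hac v vc).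
have nHmc : ~ cycles_in (ct_H m) c.
  by rewrite HabE => Hc; apply: nHac => v /Hc[].
have fmE : cycles_in (ct_W m) c -> ct_f m c = posinf_lcm (ct_f x c) (ct_f b c).
  by move: nHmc; rewrite -xbm => nH W; rewrite /= /extend asboolF // asboolT.
have fm : posinf_dvd (ct_f a c) (ct_f m c).
  by have /ct_leP[_ _] : m <= a by rewrite -abm leIl.
(* Here [ct_f b c] is 1, so [ct_f m c = ct_f x c]. *)
have [Hbc|nHbc] := pselect (cycles_in (ct_H b) c).
  have Wmc : cycles_in (ct_W m) c.
    by move=> v vc; apply: Wm_Hb; [exact: Wc|exact: Hbc].
  move: fm; rewrite fmE // (ct_f_in_H Hbc) !posinf_dvdE /posinf_lcm.
  by rewrite posinf_of_natK lcmn1.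
(* If the join takes the value infinity at [c], so does [x], and the bound is trivial. *)
have gcd_dvd : posinf_dvd (posinf_gcd (ct_f a c) (ct_f b c)) (ct_f x c).
  have := xjf c; rewrite /= /extend asboolF; last by move=> /cycles_in_join_H[].
  by case: asboolP => // _ /posinf_dvd_eq0 ->; rewrite posinf_dvdx0.
have [Wbc|nWbc] := pselect (cycles_in (ct_W b) c).
  have Wmc : cycles_in (ct_W m) c.
    by move=> v vc; apply: Wm_Wb; [exact: Wc|exact: Wbc].
  move: fm gcd_dvd (axf c); rewrite fmE // !posinf_dvdE !posinf_of_natK.
  by move=> + gcd_dvd _; move=> /dvdn_lcm_gcd; exact.
(* Infinity is coded by 0, so the gcd is [ct_f a c] itself. *)
move: gcd_dvd; rewrite (ct_f_else nHbc nWbc) !posinf_dvdE posinf_of_natK.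
by rewrite gcdn0.
Qed.

Lemma covers_joinl a b : covers b (a `&` b) -> covers (a `|` b) a.
Proof.
move=> cov_b; have [mb no_between] := cov_b; split.
  rewrite lt_neqAle leUl andbT; apply/eqP => aE.
  have /meet_idPr ba : b <= a by rewrite aE leUr.
  by move: mb; rewrite ba ltxx.
move=> [x [ax xj]].
suff xbE : x `&` b = a `&` b.
  have := modular_meet_join (covers_index _ _ cov_b) erefl xbE (ltW ax)
    (ltW xj).
  by rewrite lt_geF.
(* Were this meet equal to [b], then [x] would lie above both [a] and [b], hence above their
   join. *)
have [//|xbm] := eqVneq (x `&` b) (a `&` b); case: no_between.
exists (x `&` b); split; first by rewrite lt_neqAle eq_sym xbm leI2 ?(ltW ax).
rewrite lt_neqAle leIr andbT; apply/negP => /eqP/meet_idPr bx.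
by move: xj; rewrite le_gtF // leUx bx ltW.
Qed.

End UpperSemimodular.

(* The vertex [None] is the source of both edges; each [Some i] is a sink. *)
Definition branch : digraph :=
  @Digraph (option bool) bool (fun i => Some i) (fun _ => None).

Section NotLowerSemimodular.
Implicit Types (i : bool) (t : congruence_triple branch).

Lemma branch_no_cycle (c : gcycle branch) : False.
Proof.
by case: c => -[|e [|e' s]] //= /and3P[_ /= /andP[/eqP]].
Qed.

Lemma sink_hereditary i : @hereditary branch [set Some i].
Proof. by []. Qed.

Lemma branch_index i :
  [set None] `<=` [set v | @has_index branch [set Some i] v 1].
Proof.
move=> _ ->; apply/has_index1P; exists (~~ i); split=> [|j [_ /=]].
  by split=> // -[]; case: i.
by case: i j => -[].
Qed.

Definition sink_triple i : congruence_triple branch :=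
  @triple_of branch _ _ (fun=> None) (branch_index i) (sink_hereditary i)
    (fun _ _ _ => erefl).

Definition sink_triple0 i : congruence_triple branch :=
  @triple_of branch _ _ (fun=> None) (@sub0set _ _) (sink_hereditary i)
    (fun _ _ _ => erefl).

Lemma branch_le t1 t2 :
  ct_H t1 `<=` ct_H t2 -> ct_W t1 `\` ct_H t2 `<=` ct_W t2 -> t1 <= t2.
Proof.
by move=> leH leW; apply/ct_leP; split=> // c; case: (branch_no_cycle c).
Qed.

Lemma sink_nle i : ~~ (sink_triple (~~ i) <= sink_triple i).
Proof.
apply/negP => /ct_leP[leH _ _].
by have := leH (Some (~~ i)) erefl => -[]; case: i {leH}.
Qed.

Lemma sink_join i :
  covers (sink_triple i `|` sink_triple (~~ i)) (sink_triple i).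
Proof.
split; first by rewrite lt_leAnge leUl leUx lexx sink_nle.
move=> [y [ty]]; rewrite lt_leAnge => /andP[_ /negP]; apply.
have /ct_leP[leH leW _] := ltW ty.
have Hi : ct_H y (Some i) by exact: leH.
(* If [None] is in [ct_H y], heredity makes [ct_H y] everything and [y] is above the join. Otherwise
   [None] is in [ct_W y]; having index 1, it keeps the other sink out of [ct_H y], and [y] falls
   back below [sink_triple i]. *)
have [HN|nHN] := pselect (ct_H y None).
  have HT v : ct_H y v.
    by case: v => // j; exact: (@ct_hereditary branch y j HN).
  by rewrite leUx !branch_le // => v [].
have WN : ct_W y None by exact: leW.
have /has_index1P[j [[_ nHj] _]] := ct_index WN.
have nH : ~ ct_H y (Some (~~ i)).
  by case: (i) (j) nHj Hi => -[].
suff : y <= sink_triple i by move: ty; rewrite lt_leAnge => /andP[_ /negP].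
have HyE v : ct_H y v -> v = Some i.
  by case: v => [k|//]; case: k (i) nH => -[].
apply: branch_le => // v [Wv _]; case: v Wv => // k Wk.
by have /has_index1P[e [[]]] := ct_index Wk.
Qed.

Lemma branch_not_lower_semimodular :
  ~ lower_semimodular (congruence_triple branch).
Proof.
move=> lsm.
have [| |[_ no_between] _] := lsm (sink_triple true) (sink_triple false).
- exact: (sink_join true).
- by rewrite joinC; exact: (sink_join false).
apply: no_between; exists (sink_triple0 true).
split; rewrite lt_leAnge; apply/andP; split.
(* Relative to the empty [ct_H] of the meet, [None] has index 2, so the [ct_W] of the meet is
   empty. *)
- apply: branch_le => [v []//|v [] [_ _] /has_index1P[e [[ev nHe] e_uniq]] _].
  have := e_uniq (~~ e).
  have : ~ (ct_H (sink_triple true) `&` ct_H (sink_triple false))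
      (Some (~~ e)) by case=> ->.
  by case: e ev {nHe e_uniq} => ev nH /(_ (conj ev nH)).
- apply/negP => /ct_leP[leH _ _].
  have : ct_H (sink_triple0 true) (Some true) by [].
  by move=> /leH[_].
- by apply: branch_le => // v [].
- apply/negP => /ct_leP[_ leW _]; have [] : ct_W (sink_triple0 true) None.
  by apply: leW.
Qed.

End NotLowerSemimodular.

Theorem theorem1p3 :
  (forall G : digraph, upper_semimodular (congruence_triple G)) /\
  (exists G : digraph, ~ lower_semimodular (congruence_triple G)).
Proof.
split=> [G a b cov_a cov_b|]; last first.
  by exists branch; exact: branch_not_lower_semimodular.
by split; [|rewrite joinC]; apply: covers_joinl => //; rewrite meetC.
Qed.
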